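(* Let $n\ge 3$ and $2\le k\le n-1$, and let $M^n$ be a complete constant weighted mean curvature (CWMC) hypersurface properly immersed in the cylinder shrinking Ricci soliton $\mathbb{R}^{n+1-k}\times S^k_{\sqrt{2(k-1)}}(0)$. Then $$\inf_{M^n} H<\frac{H_f+\sqrt{H_f^2+2(n+1-k)}}{2}.$$
   Context: The cylinder shrinking Ricci soliton is $\bar M^{n+1}=\mathbb{R}^{n+1-k}\times S^k_{\sqrt{2(k-1)}}(0)$ with the product metric and potential function $f(x,y)=|x|^2/4$, where $x$ is the position vector in $\mathbb{R}^{n+1-k}$, $y$ the position vector in $\mathbb{R}^{k+1}$, and $S^k_\rho(0)\subset\mathbb{R}^{k+1}$ is the round sphere of radius $\rho$ centered at $0$. $M^n$ is an oriented immersed hypersurface with unit normal $N$; $\bar\nabla$ is the Levi-Civita connection of $\bar M$; $A(u,v)=\langle\bar\nabla_uv,N\rangle$, $\vec H=(\mathrm{tr}_{M^n}A)N=-HN$ ($H$ the scalar mean curvature), $\vec H_f=\vec H+(\bar\nabla f)^\perp=-H_fN$ ($H_f$ the weighted mean curvature), so $H_f=H-\langle\bar\nabla f,N\rangle$. $M^n$ is CWMC if $H_f$ is constant. *)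

(* Defs.v *)
From HB Require Import structures.
From mathcomp Require Import all_boot all_order all_algebra.
From mathcomp Require Import all_classical all_reals all_analysis.

Set Implicit Arguments.
Unset Strict Implicit.
Unset Printing Implicit Defensive.

Import Order.TTheory GRing.Theory Num.Theory.
Import numFieldNormedType.Exports.

Local Open Scope classical_set_scope.
Local Open Scope ring_scope.

(* The library norm on 'rV[R]_d is the sup norm; [enorm] is the Euclidean one.
   They induce the same topology, hence the same notions of limit, derivative
   and compactness. *)
Definition dotp (R : realType) (d : nat) (u v : 'rV[R]_d) : R :=
  \sum_(i < d) u 0 i * v 0 i.

Definition enorm (R : realType) (d : nat) (u : 'rV[R]_d) : R :=
  Num.sqrt (dotp u u).

Definition partial (R : realType) (n : nat) (V : normedModType R)
    (i : 'I_n) (f : 'rV[R]_n -> V) : 'rV[R]_n -> V :=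
  fun x => 'D_(delta_mx 0 i : 'rV[R]_n) f x.

(* [Cr r U f]: f is of class C^r on U. It is only used for U open, so all the
   conditions at a point of U depend on f restricted to U only. *)
Fixpoint Cr (R : realType) (n : nat) (V : normedModType R) (r : nat)
    (U : set 'rV[R]_n) (f : 'rV[R]_n -> V) : Prop :=
  match r with
  | 0 => forall x, U x -> {for x, continuous f}
  | r'.+1 => (forall x, U x -> differentiable f x) /\
             (forall i : 'I_n, Cr r' U (partial i f))
  end.

Definition smooth_on (R : realType) (n : nat) (V : normedModType R)
    (U : set 'rV[R]_n) (f : 'rV[R]_n -> V) : Prop :=
  forall r, Cr r U f.

(* [cmap] is a homeomorphism from [cdom] onto [cimg] with inverse [cinv]; the
   values of [cmap] off [cdom] and of [cinv] off [cimg] are irrelevant. *)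
Record chart (R : realType) (n : nat) (M : topologicalType) := Chart {
  cdom : set M;
  cimg : set 'rV[R]_n;
  cmap : M -> 'rV[R]_n;
  cinv : 'rV[R]_n -> M;
  cdom_open : open cdom;
  cimg_open : open cimg;
  cmap_img : forall p, cdom p -> cimg (cmap p);
  cinv_dom : forall x, cimg x -> cdom (cinv x);
  cmapK : forall p, cdom p -> cinv (cmap p) = p;
  cinvK : forall x, cimg x -> cmap (cinv x) = x;
  cmap_continuous : forall p, cdom p -> {for p, continuous cmap};
  cinv_continuous : forall x, cimg x -> {for x, continuous cinv} }.

(* Manifolds are nonempty; they are not required to be connected. *)
Record manifold (R : realType) (n : nat) := Manifold {
  carrier :> topologicalType;
  atlas : set (chart R n carrier);
  manifold_nonempty : [set: carrier] !=set0;
  manifold_hausdorff : hausdorff_space carrier;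
  manifold_second_countable : @second_countable carrier;
  atlas_cover : forall p : carrier, exists c, atlas c /\ cdom c p;
  atlas_smooth : forall c c', atlas c -> atlas c' ->
    smooth_on (cimg c `&` cinv c @^-1` cdom c') (cmap c' \o cinv c) }.

Definition chart_at (R : realType) (n : nat) (M : manifold R n) (p : M) :
  chart R n M := projT1 (cid (atlas_cover p)).

Definition smooth_map (R : realType) (n : nat) (V : normedModType R)
    (M : manifold R n) (F : M -> V) : Prop :=
  forall c, atlas c -> smooth_on (cimg c) (F \o cinv c).

(* A point of R^m x R^(k+1) is a row p with x = lsubmx p and y = rsubmx p. *)
Definition sphere_radius (R : realType) (k : nat) : R :=
  Num.sqrt (2 * (k%:R - 1)).

Definition cylinder (R : realType) (m k : nat) : set 'rV[R]_(m + k.+1) :=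
  [set p | enorm (rsubmx p) = sphere_radius R k].

(* Orthogonal projection of R^m x R^(k+1) onto the tangent space of the
   cylinder at p, whose normal line is spanned by (0, y). *)
Definition tproj (R : realType) (m k : nat) (p v : 'rV[R]_(m + k.+1)) :
    'rV[R]_(m + k.+1) :=
  row_mx (lsubmx v)
    (rsubmx v -
     (dotp (rsubmx v) (rsubmx p) / dotp (rsubmx p) (rsubmx p)) *: rsubmx p).

Definition potential (R : realType) (m k : nat) (p : 'rV[R]_(m + k.+1)) : R :=
  enorm (lsubmx p) ^+ 2 / 4.

(* Gradient on the cylinder of (the restriction of) an ambient function. *)
Definition gradbar (R : realType) (m k : nat)
    (phi : 'rV[R]_(m + k.+1) -> R) (p : 'rV[R]_(m + k.+1)) :
    'rV[R]_(m + k.+1) :=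
  tproj p (\row_i partial i phi p).

Section hypersurface.
Context {R : realType} {m k n : nat} (M : manifold R n).
Variables (F N : M -> 'rV[R]_(m + k.+1)).

(* Row i is the coordinate vector field dF(d/dx_i), at the chart point x. *)
Definition frame (c : chart R n M) (x : 'rV[R]_n) : 'M[R]_(n, m + k.+1) :=
  \matrix_(i < n) partial i (F \o cinv c) x.

(* F maps into the cylinder and N is a unit normal field of F in the cylinder.
   The cylinder being orientable, choosing N amounts to orienting M. *)
Record oriented_immersed_hypersurface : Prop := {
  himm_cylinder : forall p, cylinder (F p);
  himm_smooth : smooth_map F;
  himm_immersion : forall c x, atlas c -> cimg c x -> row_free (frame c x);
  hnormal_smooth : smooth_map N;
  hnormal_unit : forall p, enorm (N p) = 1;
  hnormal_tangent : forall p, tproj (F p) (N p) = N p;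
  hnormal_normal : forall c x i, atlas c -> cimg c x ->
    dotp (N (cinv c x)) (row i (frame c x)) = 0 }.

Definition properly_immersed : Prop :=
  forall K : set 'rV[R]_(m + k.+1),
    K `<=` @cylinder R m k -> compact K -> compact (F @^-1` K).

Definition induced_metric (c : chart R n M) (x : 'rV[R]_n) : 'M[R]_n :=
  \matrix_(i, j) dotp (row i (frame c x)) (row j (frame c x)).

(* The metric of the cylinder is induced by the Euclidean one, so its
   Levi-Civita connection is the tangential part of the Euclidean derivative;
   here the derivative along d/dx_i of a vector field V along F. *)
Definition nablabar (c : chart R n M) (i : 'I_n)
    (V : 'rV[R]_n -> 'rV[R]_(m + k.+1)) (x : 'rV[R]_n) : 'rV[R]_(m + k.+1) :=
  tproj (F (cinv c x)) (partial i V x).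

Definition second_form (c : chart R n M) (x : 'rV[R]_n) : 'M[R]_n :=
  \matrix_(i, j)
    dotp (nablabar c i (fun z => row j (frame c z)) x) (N (cinv c x)).

(* H = - tr A, the trace being g^(ij) A_ij in any chart around p: a change of
   coordinates conjugates (invmx g *m A), so the choice is immaterial. *)
Definition mean_curvature (p : M) : R :=
  let c := chart_at p in
  let x := cmap c p in
  - \tr (invmx (induced_metric c x) *m second_form c x).

Definition weighted_mean_curvature (p : M) : R :=
  mean_curvature p - dotp (gradbar (@potential R m k) (F p)) (N p).

Definition C1_curve (g : R -> M) : Prop :=
  continuous g /\
  forall c t, atlas c -> cdom c (g t) ->
    derivable (cmap c \o g) t 1 /\
    {for t, continuous (derive1 (cmap c \o g))}.

(* The induced norm of g'(t) is the Euclidean norm of dF(g'(t)) = (F o g)'(t). *)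
Definition curve_length (g : R -> M) : \bar R :=
  (\int[@lebesgue_measure R]_(t in `[0%R, 1%R])
     (enorm (derive1 (F \o g) t))%:E)%E.

(* Using C^1 curves on the whole line instead of piecewise C^1 curves on [0, 1]
   does not change the infimum: curves are not required to be regular, so they
   can be slowed down to rest at corners and endpoints. *)
Definition riemannian_dist (p q : M) : \bar R :=
  ereal_inf [set curve_length g | g in
    [set g : R -> M | [/\ C1_curve g, g 0 = p & g 1 = q]]].

Definition complete_hypersurface : Prop :=
  forall u : nat -> M,
    (forall e : R, 0 < e -> exists n0 : nat, forall i j : nat,
       (n0 <= i)%N -> (n0 <= j)%N -> (riemannian_dist (u i) (u j) < e%:E)%E) ->
    exists l : M, u @ \oo --> l.

End hypersurface.

(* Main.v *)
Require Import Defs.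
From mathcomp Require Import all_boot all_order all_algebra.
From mathcomp Require Import all_classical all_reals all_analysis.
From mathcomp Require Import ring lra.
Import Order.TTheory GRing.Theory Num.Theory.
Import numFieldNormedType.Exports.
Local Open Scope classical_set_scope.
Local Open Scope ring_scope.

Set Implicit Arguments.
Unset Strict Implicit.
Unset Printing Implicit Defensive.

(** Write F = (x, y) for the immersion into R^m x S^k with m = n + 1 - k, and
    let c be the threshold, the larger root of 2 c (c - H_f) = m. The proof looks
    at one point only, a point p where the potential f = |x|^2 / 4 is minimal
    on the hypersurface; p exists because F is proper and the sublevel sets of
    f in the cylinder are compact ([exists_potential_min]).

    On a hypersurface of the cylinder
      Delta f = (m - |N_x|^2) / 2 - H <grad f, N>,
    where N_x is the R^m component of N. Here <grad f, N> = <x, N_x> / 2, and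
    the definition of H_f turns this number into H - H_f. The minimum principle
    gives Delta f >= 0 at p, that is
      2 H (H - H_f) <= m - |N_x|^2.
    If H >= c at p, then 2 H (H - H_f) >= m ([weighted_threshold]), hence
    N_x = 0 at p, hence H - H_f = <x, N_x> / 2 = 0 and 2 H (H - H_f) = 0 < m,
    a contradiction. So H(p) < c, which bounds the infimum strictly.

    The inequality Delta f >= 0 at p is [potential_min_laplacian_ge0]. At a
    critical point no Christoffel symbol enters: the second derivatives of f
    along the lines of a chart are those of [sq_lsubmx_min_test], and since x is
    then normal to the hypersurface, (x, 0) = <x, N_x> N
    ([normal_component]), they are given by the second fundamental form.
    Taking the trace with the inverse metric is [trace_nonneg_form]: the
    inverse Gram matrix of a frame E is W W^T with W = (E E^T)^-1 E, so
    the trace is a sum of values of the form over the columns of W, and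
    W^T E is the orthogonal projection onto the tangent space, whose diagonal
    sums to m - |N_x|^2 over the R^m coordinates. *)

(** * Euclidean scalar product *)

Lemma dotpE {R : realType} {d : nat} (u v : 'rV[R]_d) : dotp u v = (u *m v^T) 0 0.
Proof. by rewrite mxE; apply: eq_bigr => i _; rewrite mxE. Qed.

Lemma dotpC {R : realType} {d : nat} (u v : 'rV[R]_d) : dotp u v = dotp v u.
Proof. by apply: eq_bigr => i _; rewrite mulrC. Qed.

Lemma dotpBl {R : realType} {d : nat} (u v w : 'rV[R]_d) :
  dotp (u - v) w = dotp u w - dotp v w.
Proof. by rewrite !dotpE mulmxBl !mxE. Qed.

Lemma dotpZl {R : realType} {d : nat} a (u w : 'rV[R]_d) :
  dotp (a *: u) w = a * dotp u w.
Proof. by rewrite !dotpE -scalemxAl mxE. Qed.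

Lemma dotp_suml {R : realType} {d : nat} (I : finType) (u : I -> 'rV[R]_d) w :
  dotp (\sum_i u i) w = \sum_i dotp (u i) w.
Proof. by rewrite dotpE mulmx_suml summxE; apply: eq_bigr => i _; rewrite dotpE. Qed.

Lemma dotp_ge0 {R : realType} {d : nat} (u : 'rV[R]_d) : 0 <= dotp u u.
Proof. by apply: sumr_ge0 => i _; rewrite -expr2 sqr_ge0. Qed.

Lemma dotp_eq0 {R : realType} {d : nat} (u : 'rV[R]_d) : dotp u u = 0 -> u = 0.
Proof.
move=> /eqP; rewrite psumr_eq0 => [/allP u0|i _]; last by rewrite -expr2 sqr_ge0.
apply/rowP => i; rewrite mxE; apply/eqP.
by have := u0 i (mem_index_enum _); rewrite /= mulf_eq0 orbb.
Qed.

Lemma sqr_le_dotp {R : realType} {d : nat} (u : 'rV[R]_d) j :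
  u 0 j ^+ 2 <= dotp u u.
Proof.
rewrite /dotp (bigD1 j) //= -expr2 lerDl.
by apply: sumr_ge0 => i _; rewrite -expr2 sqr_ge0.
Qed.

Lemma enorm_sqr {R : realType} {d : nat} (u : 'rV[R]_d) : enorm u ^+ 2 = dotp u u.
Proof. by rewrite sqr_sqrtr // dotp_ge0. Qed.

Lemma dotp_submx {R : realType} {m r : nat} (u w : 'rV[R]_(m + r)) :
  dotp u w = dotp (lsubmx u) (lsubmx w) + dotp (rsubmx u) (rsubmx w).
Proof.
by rewrite /dotp big_split_ord /=; congr (_ + _); apply: eq_bigr => i _; rewrite !mxE.
Qed.


(** * Derivatives along lines and minima *)

(** Differentiating along a line reduces a statement about directional
    derivatives on a normed module to one real variable; the two difference
    quotients are the same function. *)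
Lemma is_derive_line {R : realType} {V : normedModType R} (f : V -> R)
    (z v : V) (t df : R) :
  is_derive (z + t *: v) v f df ->
  is_derive (t : R) 1 (fun s : R => f (z + s *: v)) df.
Proof.
move=> [fv <-].
have E : (fun h : R => h^-1 *: (f (h *: v + (z + t *: v)) - f (z + t *: v)))
  = (fun h : R => h^-1 *: (f (z + (h *: (1 : R) + t) *: v) - f (z + t *: v))).
  apply/funext => h; congr (_ *: (f _ - _)).
  by rewrite scalerDl addrCA -[h *: 1]/(h * 1) mulr1.
split; first by move: fv; rewrite /derivable E.
by rewrite /derive E.
Qed.

Lemma derive_min_eq0 {R : realType} (f df : R -> R) :
  (\forall t \near (0 : R), is_derive (t : R) 1 f (df t)) ->
  (forall t, f 0 <= f t) -> df 0 = 0.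
Proof.
move=> /nbhs_ballP[e /= e0 fdf] fmin.
have ine t : t \in `]-e, e[ -> is_derive (t : R) 1 f (df t).
  rewrite in_itv /= => te; apply: fdf.
  by rewrite /ball /= sub0r normrN ltr_norml.
have in0 : 0 \in `]-e, e[ by rewrite in_itv /= oppr_lt0 e0.
have [] : is_derive (0 : R) 1 f 0.
  apply: (@derive1_at_min _ f (- e) e 0) => //; first by lra.
  by move=> t /ine [].
by have [_ ->] := ine 0 in0.
Qed.

(** If l < 0, then df, which vanishes at 0, is negative just to the right of 0,
    so by the mean value theorem f drops below its minimum. *)
Lemma second_derive_min_ge0 {R : realType} (f df : R -> R) (l : R) :
  (\forall t \near (0 : R), is_derive (t : R) 1 f (df t)) ->
  is_derive (0 : R) 1 df l ->
  (forall t, f 0 <= f t) -> 0 <= l.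
Proof.
move=> ffd [dfl lE] fmin.
have df0 := derive_min_eq0 ffd fmin.
rewrite leNgt; apply/negP => l0.
have dneg : \forall t \near (0 : R)^', t^-1 * df t < 0.
  have : (fun h : R => h^-1 *: (df (h *: 1 + 0) - df 0)) @ 0^' --> l.
    by move: dfl; rewrite /derivable -[in X in _ -> X]lE.
  move/cvgr_lt => /(_ _ l0); apply: filterS => t.
  by rewrite df0 subr0 addr0 -[t *: 1]/(t * 1) mulr1.
have [e /= e0 fe] := (nbhs_ballP _ _).1 ffd.
have [d /= d0 fd] := (nbhs_ballP _ _).1 dneg.
(* On ]0, b], f has derivative df and df is negative. *)
pose b := Num.min e d / 2.
have m0 : 0 < Num.min e d by rewrite lt_min e0 d0.
have b0 : 0 < b by rewrite /b; lra.
have be : b < e by rewrite (@lt_le_trans _ _ (Num.min e d)) ?ge_min ?lexx // /b; lra.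
have bd : b < d.
  by rewrite (@lt_le_trans _ _ (Num.min e d)) ?ge_min ?lexx ?orbT // /b; lra.
have ine t : 0 <= t -> t <= b -> is_derive (t : R) 1 f (df t).
  move=> t0 tb; apply: fe; rewrite /ball /= sub0r normrN ger0_norm //; lra.
have [||c] := @MVT R f df 0 b b0.
- by move=> x; rewrite in_itv /= => /andP[x0 xb]; apply: ine; exact: ltW.
- apply: continuous_in_subspaceT => x; rewrite inE /= in_itv /= => /andP[x0 xb].
  have [H _] := ine x x0 xb.
  exact/differentiable_continuous/derivable1_diffP.
rewrite in_itv /= => /andP[c0 cb] fE.
have := fd c; rewrite /ball /= sub0r normrN gtr0_norm // => /(_ (lt_trans cb bd)).
move=> /(_ (lt0r_neq0 c0)); rewrite pmulr_rlt0 ?invr_gt0 // => dc.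
have : df c * (b - 0) < 0 by rewrite subr0 pmulr_llt0.
by have := fmin b; rewrite -fE; lra.
Qed.

(** Partial derivatives compute all directional derivatives, by linearity of the
    differential. *)
Lemma differentiable_is_derive {R : realType} {n : nat} {V : normedModType R}
    (f : 'rV[R]_n -> V) (x v : 'rV[R]_n) :
  differentiable f x -> is_derive x v f (\sum_i v 0 i *: partial i f x).
Proof.
move=> fx; split; first exact: diff_derivable.
rewrite deriveE // {1}[v]row_sum_delta linear_sum; apply: eq_bigr => i _.
by rewrite linearZ /partial deriveE.
Qed.

Lemma is_derive_coord {R : realType} {V : normedModType R} {m n : nat}
    (f : V -> 'M[R]_(m, n)) (x v : V) (df : 'M[R]_(m, n)) i j :
  is_derive x v f df -> is_derive x v (fun z => f z i j) (df i j).
Proof.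
move=> [fv <-]; split; first exact: (derivable_mxP _ _ _).1.
by rewrite derive_mx // mxE.
Qed.

Lemma is_derive_dotp {R : realType} {V : normedModType R} {d : nat}
    (u w : V -> 'rV[R]_d) (x v : V) (du dw : 'rV[R]_d) :
  (forall j, is_derive x v (fun z => u z 0 j) (du 0 j)) ->
  (forall j, is_derive x v (fun z => w z 0 j) (dw 0 j)) ->
  is_derive x v (fun z => dotp (u z) (w z)) (dotp du (w x) + dotp (u x) dw).
Proof.
move=> ud wd.
rewrite (_ : (fun z => _) =
    \sum_(j < d) ((fun z => u z 0 j) * (fun z => w z 0 j))); last first.
  by apply/funext => z; rewrite fct_sumE.
apply: is_derive_eq; rewrite /dotp -big_split /=; apply: eq_bigr => j _.
by rewrite addrC; congr (_ + _); exact: mulrC.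
Qed.

Lemma is_derive_lsubmx {R : realType} {V : normedModType R} {m r : nat}
    (f : V -> 'rV[R]_(m + r)) (x v : V) df j :
  is_derive x v f df -> is_derive x v (fun z => lsubmx (f z) 0 j) (lsubmx df 0 j).
Proof.
move=> fd; rewrite mxE; under eq_fun do rewrite mxE.
exact: is_derive_coord.
Qed.

Lemma is_derive_rsubmx {R : realType} {V : normedModType R} {m r : nat}
    (f : V -> 'rV[R]_(m + r)) (x v : V) df j :
  is_derive x v f df -> is_derive x v (fun z => rsubmx (f z) 0 j) (rsubmx df 0 j).
Proof.
move=> fd; rewrite mxE; under eq_fun do rewrite mxE.
exact: is_derive_coord.
Qed.

(** First and second order conditions for a minimum of |x o G|^2, in the direction
    v. They are stated with the partial derivatives of G, because these are what
    the frame and the second fundamental form are made of. *)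
Lemma sq_lsubmx_min_test {R : realType} {n m r : nat} (U : set 'rV[R]_n)
    (G : 'rV[R]_n -> 'rV[R]_(m + r)) (z v : 'rV[R]_n) :
  open U -> Cr 2 U G -> U z ->
  (forall y, dotp (lsubmx (G z)) (lsubmx (G z)) <=
             dotp (lsubmx (G y)) (lsubmx (G y))) ->
  let dG := \sum_i v 0 i *: partial i G z in
  let ddG := \sum_i \sum_j (v 0 i * v 0 j) *: partial i (partial j G) z in
  dotp (lsubmx dG) (lsubmx (G z)) = 0 /\
  0 <= dotp (lsubmx dG) (lsubmx dG) + dotp (lsubmx ddG) (lsubmx (G z)).
Proof.
move=> oU [dfG C1] Uz Gmin dG ddG.
pose DG y := \sum_j v 0 j *: partial j G y.
have DG1 y : U y -> is_derive y v G (DG y).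
  by move=> Uy; apply: differentiable_is_derive; exact: dfG.
have DG2 : is_derive z v DG ddG.
  have -> : DG = \sum_j (v 0 j \*: partial j G).
    by apply/funext => y; rewrite fct_sumE.
  rewrite /ddG exchange_big /=; apply: is_derive_sum => j.
  apply: is_derive_eq; first apply: is_deriveZ.
    by apply: differentiable_is_derive; exact: (C1 j).1.
  by rewrite scaler_sumr; apply: eq_bigr => i _; rewrite scalerA mulrC.
pose L (u : 'rV[R]_(m + r)) := lsubmx u.
pose phi y := dotp (L (G y)) (L (G y)).
pose dphi y := dotp (L (DG y)) (L (G y)) + dotp (L (G y)) (L (DG y)).
pose f t := phi (z + t *: v).
pose df t := dphi (z + t *: v).
have fmin t : f 0 <= f t by rewrite /f scale0r addr0; exact: Gmin.
have fdf : \forall t \near (0 : R), is_derive (t : R) 1 f (df t).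
  have lineC : {for 0, continuous (fun t : R => z + t *: v)}.
    apply: cvgD; first exact: cvg_cst.
    by apply: cvgZ; [exact: cvg_id | exact: cvg_cst].
  have : \forall t \near (0 : R), U (z + t *: v).
    by apply: lineC; rewrite scale0r addr0; exact: open_nbhs_nbhs.
  apply: filterS => t Ut; apply: is_derive_line.
  by apply: is_derive_dotp => j; apply: is_derive_lsubmx; exact: DG1.
have dfl : is_derive (0 : R) 1 df
    ((dotp (L ddG) (L (G z)) + dotp (L dG) (L dG)) +
     (dotp (L dG) (L dG) + dotp (L (G z)) (L ddG))).
  apply: is_derive_line; rewrite scale0r addr0; apply: is_deriveD;
    by apply: is_derive_dotp => j; apply: is_derive_lsubmx => //; exact: DG1.
split.
  have : dotp (L dG) (L (G z)) + dotp (L dG) (L (G z)) = 0.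
    rewrite -[RHS](derive_min_eq0 fdf fmin) /df /dphi scale0r addr0.
    by rewrite [X in _ = _ + X]dotpC.
  by rewrite /L; lra.
have := second_derive_min_ge0 fdf dfl fmin.
by rewrite [dotp (L (G z)) _]dotpC /L; lra.
Qed.


(** * Tangent frames of a hypersurface and traces *)

(** A vector v in the kernel of E E^T satisfies |v E|^2 = 0. *)
Lemma gram_unit {R : realType} {n d : nat} (E : 'M[R]_(n, d)) :
  row_free E -> E *m E^T \in unitmx.
Proof.
move=> Efree; rewrite -row_free_unit; apply: inj_row_free => v vg0.
apply: (row_free_inj Efree); rewrite mul0mx; apply: dotp_eq0.
by rewrite dotpE trmx_mul mulmxA -[v *m E *m _]mulmxA vg0 mul0mx mxE.
Qed.

(** The orthogonal projections onto the row space of E and onto its complement,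
    of which the rows of C are an orthonormal basis, add up to the identity. The
    dimension count makes col_mx E C square, so that a one-sided inverse of it
    is two-sided. *)
Lemma orthogonal_decomposition {R : realType} {n r d : nat}
    (E : 'M[R]_(n, d)) (C : 'M[R]_(r, d)) :
  d = (n + r)%N -> row_free E -> E *m C^T = 0 -> C *m C^T = 1%:M ->
  E^T *m invmx (E *m E^T) *m E + C^T *m C = 1%:M.
Proof.
move=> dE; subst d => Efree EC CC.
have gu := gram_unit Efree.
have CE : C *m E^T = 0 by rewrite -[C]trmxK -trmx_mul EC trmx0.
rewrite -mul_row_col; apply: mulmx1C.
rewrite mul_col_row mulmxA mulmxV // EC CC mulmxA CE mul0mx.
by rewrite -scalar_mx_block.
Qed.

(** The case of a tangent frame E, the unit normal nu of the hypersurface in the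
    cylinder and the unit normal eta of the cylinder. *)
Lemma frame_decomposition {R : realType} {n d : nat}
    (E : 'M[R]_(n, d)) (nu eta : 'rV[R]_d) :
  d = (n + (1 + 1))%N -> row_free E ->
  E *m nu^T = 0 -> E *m eta^T = 0 ->
  dotp nu nu = 1 -> dotp eta eta = 1 -> dotp nu eta = 0 ->
  E^T *m invmx (E *m E^T) *m E + nu^T *m nu + eta^T *m eta = 1%:M.
Proof.
move=> dE Efree En Ee nn ee ne.
pose C := col_mx nu eta.
have EC : E *m C^T = 0 by rewrite /C tr_col_mx mul_mx_row En Ee row_mx0.
have m11 (u w : 'rV[R]_d) : u *m w^T = (dotp u w)%:M.
  by rewrite [LHS]mx11_scalar dotpE.
have CC : C *m C^T = 1%:M.
  rewrite /C tr_col_mx mul_col_row !m11 nn ee ne dotpC ne.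
  by rewrite (scalar_mx_block 1 1) raddf0.
rewrite -(orthogonal_decomposition dE Efree EC CC).
by rewrite /C tr_col_mx mul_row_col addrA.
Qed.

(** A vector tangent to the cylinder and normal to the hypersurface is a multiple
    of the unit normal. *)
Lemma normal_component {R : realType} {n d : nat}
    (E : 'M[R]_(n, d)) (nu eta x : 'rV[R]_d) :
  d = (n + (1 + 1))%N -> row_free E ->
  E *m nu^T = 0 -> E *m eta^T = 0 ->
  dotp nu nu = 1 -> dotp eta eta = 1 -> dotp nu eta = 0 ->
  E *m x^T = 0 -> dotp x eta = 0 -> x = dotp x nu *: nu.
Proof.
move=> dE Efree En Ee nn ee ne Ex xe.
have xE : x *m E^T = 0 by rewrite -[x]trmxK -trmx_mul Ex trmx0.
rewrite -[LHS]mulmx1 -(frame_decomposition dE Efree En Ee nn ee ne).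
rewrite !mulmxDr !mulmxA xE !mul0mx add0r.
rewrite [x *m nu^T]mx11_scalar [x *m eta^T]mx11_scalar -!dotpE xe.
by rewrite !mul_scalar_mx scale0r addr0.
Qed.

(** The trace of a nonnegative quadratic form with respect to the metric E E^T is
    nonnegative; the form is the Hessian of |x|^2 / 2 at a minimum. The trace of
    its first part is that of the tangential projection restricted to R^m, and
    eta does not contribute because it is vertical. *)
Lemma trace_nonneg_form {R : realType} {m n r : nat} (E : 'M[R]_(n, m + r))
    (A : 'M[R]_n) (nu eta : 'rV[R]_(m + r)) (s : R) :
  (m + r = n + (1 + 1))%N -> row_free E ->
  E *m nu^T = 0 -> E *m eta^T = 0 -> dotp nu nu = 1 -> dotp eta eta = 1 ->
  dotp nu eta = 0 -> lsubmx eta = 0 ->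
  (forall v : 'rV[R]_n,
    0 <= dotp (lsubmx (v *m E)) (lsubmx (v *m E)) + s * (v *m A *m v^T) 0 0) ->
  0 <= m%:R - dotp (lsubmx nu) (lsubmx nu)
       + s * \tr (invmx (E *m E^T) *m A).
Proof.
move=> dE Efree En Ee nn ee ne leta pos.
have gu := gram_unit Efree.
have dec := frame_decomposition dE Efree En Ee nn ee ne.
set g := E *m E^T in dec gu *.
have gT : g^T = g by rewrite trmx_mul trmxK.
have giT : (invmx g)^T = invmx g by rewrite trmx_inv gT.
pose W := invmx g *m E.
have WW : W *m W^T = invmx g.
  by rewrite trmx_mul giT !mulmxA -[_ *m E *m E^T]mulmxA mulVmx // mul1mx.
(* P is the orthogonal projection onto the row space of E. *)
pose P := W^T *m E.
have PE : P = 1%:M - nu^T *m nu - eta^T *m eta.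
  by rewrite -dec /P trmx_mul giT addrAC !addrK.
have PT : P^T = P.
  by rewrite /P trmx_mul trmxK /W trmx_mul giT mulmxA.
have symP a b : P a b = P b a by rewrite -[in LHS]PT [LHS]mxE.
have EW : E *m W^T = 1%:M by rewrite trmx_mul giT mulmxA mulmxV.
have PP : P *m P = P by rewrite /P mulmxA -[_ *m E *m _]mulmxA EW mulmx1.
have pdiag (j : 'I_m) : P (lshift r j) (lshift r j) = 1 - lsubmx nu 0 j ^+ 2.
  have e0 : eta 0 (lshift r j) = 0.
    by have := congr1 (fun X : 'rV_m => X 0 j) leta; rewrite !mxE.
  by rewrite PE !mxE !big_ord1 !mxE e0 mulr0 subr0 eqxx mulr1n expr2.
have rowWE a : row a W^T *m E = row a P by rewrite -row_mul.
have S1 : \sum_a dotp (lsubmx (row a W^T *m E)) (lsubmx (row a W^T *m E)) =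
    m%:R - dotp (lsubmx nu) (lsubmx nu).
  rewrite exchange_big /=.
  transitivity (\sum_(j < m) (1 - lsubmx nu 0 j ^+ 2)).
    apply: eq_bigr => j _; rewrite -pdiag -[in RHS]PP mxE; apply: eq_bigr => a _.
    by rewrite rowWE mxE [row a P _ _]mxE [X in X * _]symP.
  by rewrite big_split /= sumrN sumr_const card_ord; congr (_ - _); apply: eq_bigr.
have S2 : \sum_a (row a W^T *m A *m (row a W^T)^T) 0 0 = \tr (invmx g *m A).
  rewrite -WW -mulmxA mxtrace_mulC.
  apply: eq_bigr => a _; rewrite -row_mul tr_row trmxK !mxE; apply: eq_bigr => b _.
  by rewrite !mxE.
by rewrite -S1 -S2 mulr_sumr -big_split; apply: sumr_ge0 => a _; exact: pos.
Qed.


(** * Geometry of the cylinder *)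

Lemma dotp_rsubmx_cylinder {R : realType} {m k : nat} (p : 'rV[R]_(m + k.+1)) :
  (2 <= k)%N -> cylinder p -> dotp (rsubmx p) (rsubmx p) = 2 * (k%:R - 1).
Proof.
move=> k2 pc; rewrite -enorm_sqr pc sqr_sqrtr // mulr_ge0 //.
by rewrite subr_ge0 ler1n; apply: leq_trans k2.
Qed.

(** An orthogonal projection is self-adjoint. *)
Lemma dotp_tproj {R : realType} {m k : nat} (p v w : 'rV[R]_(m + k.+1)) :
  dotp (tproj p v) w = dotp v (tproj p w).
Proof.
rewrite [LHS]dotp_submx [RHS]dotp_submx /tproj !row_mxKl !row_mxKr.
congr (_ + _); rewrite dotpBl dotpZl [RHS]dotpC dotpBl dotpZl.
rewrite [dotp (rsubmx w) (rsubmx v)]dotpC.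
rewrite [dotp (rsubmx w) (rsubmx p)]dotpC [dotp (rsubmx v) (rsubmx p)]dotpC.
by ring.
Qed.

Lemma tproj_fixed_dotp {R : realType} {m k : nat} (p v : 'rV[R]_(m + k.+1)) :
  dotp (rsubmx p) (rsubmx p) != 0 -> tproj p v = v ->
  dotp (rsubmx v) (rsubmx p) = 0.
Proof.
move=> p0 /(congr1 rsubmx); rewrite row_mxKr => /(congr1 (fun w => dotp w (rsubmx p))).
by rewrite dotpBl dotpZl divfK // subrr => <-.
Qed.

(** The Euclidean gradient of |x|^2 / 4 is (x / 2, 0), and projecting it to the
    cylinder does not change its product with a tangent vector. *)
Lemma dotp_gradbar_potential {R : realType} {m k : nat}
    (p nu : 'rV[R]_(m + k.+1)) :
  tproj p nu = nu ->
  dotp (gradbar (@potential R m k) p) nu = dotp (lsubmx p) (lsubmx nu) / 2.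
Proof.
move=> pnu; rewrite /gradbar dotp_tproj pnu.
have grad i : partial i (@potential R m k) p =
    dotp (lsubmx (delta_mx 0 i : 'rV[R]_(m + k.+1))) (lsubmx p) / 2.
  set e := delta_mx 0 i.
  have H : is_derive p e (fun z : 'rV[R]_(m + k.+1) => dotp (lsubmx z) (lsubmx z))
      (dotp (lsubmx e) (lsubmx p) + dotp (lsubmx p) (lsubmx e)).
    by apply: is_derive_dotp => j; apply: is_derive_lsubmx; exact: is_derive_id.
  have [_] := is_deriveZ 4^-1 H.
  rewrite /partial (_ : _ \*: _ = @potential R m k); last first.
    by apply/funext => z; rewrite /potential enorm_sqr mulrC.
  move=> ->; rewrite [dotp (lsubmx p) _]dotpC -[_ *: _]/(_ * _).
  by set t := dotp _ _; lra.
transitivity ((\sum_i dotp (lsubmx (nu 0 i *: delta_mx 0 i)) (lsubmx p)) / 2).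
  by rewrite mulr_suml; apply: eq_bigr => i _; rewrite mxE grad linearZ dotpZl; ring.
by rewrite -dotp_suml -linear_sum -row_sum_delta dotpC.
Qed.

Lemma continuous_sq_lsubmx {R : realType} {m r : nat} :
  continuous (fun p : 'rV[R]_(m + r) => dotp (lsubmx p) (lsubmx p)).
Proof.
rewrite (_ : (fun p => _) =
    fun p : 'rV[R]_(m + r) => \sum_j p 0 (lshift r j) * p 0 (lshift r j)); last first.
  by apply/funext => p; apply: eq_bigr => j _; rewrite mxE.
apply: (continuous_big (@add_continuous R)) => j _ p.
by apply: continuousM; exact: (@coord_continuous _ _ _ 0 (lshift r j) p).
Qed.

Lemma continuous_sq_rsubmx {R : realType} {m r : nat} :
  continuous (fun p : 'rV[R]_(m + r) => dotp (rsubmx p) (rsubmx p)).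
Proof.
rewrite (_ : (fun p => _) =
    fun p : 'rV[R]_(m + r) => \sum_j p 0 (rshift m j) * p 0 (rshift m j)); last first.
  by apply/funext => p; apply: eq_bigr => j _; rewrite mxE.
apply: (continuous_big (@add_continuous R)) => j _ p.
by apply: continuousM; exact: (@coord_continuous _ _ _ 0 (rshift m j) p).
Qed.

(** The coordinates satisfy |p_i|^2 <= |x|^2 + |y|^2, which is bounded because |y|
    is constant on the cylinder. *)
Lemma compact_cylinder_sublevel {R : realType} {m k : nat} (b : R) :
  (2 <= k)%N ->
  compact [set p : 'rV[R]_(m + k.+1) |
    cylinder p /\ dotp (lsubmx p) (lsubmx p) <= b].
Proof.
move=> k2; pose rho2 : R := 2 * (k%:R - 1).
(* |t| <= (1 + t^2) / 2 <= 1 + t^2 turns the bound on p_i^2 into one on |p_i|. *)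
pose B := b + rho2 + 1.
have boxC : compact [set v : 'rV[R]_(m + k.+1) | forall i, `[- B, B]%classic (v ord0 i)].
  by apply: (@rV_compact _ _ (fun=> `[- B, B]%classic)) => _; exact: segment_compact.
refine (subclosed_compact _ boxC _).
- have -> : [set p : 'rV[R]_(m + k.+1) |
      cylinder p /\ dotp (lsubmx p) (lsubmx p) <= b] =
    (fun p : 'rV[R]_(m + k.+1) => dotp (rsubmx p) (rsubmx p)) @^-1` [set rho2] `&`
    (fun p : 'rV[R]_(m + k.+1) => dotp (lsubmx p) (lsubmx p)) @^-1` [set t | t <= b].
    apply/seteqP; split => p /= [pc pb]; split => //.
      exact: dotp_rsubmx_cylinder.
    by rewrite /cylinder /= /enorm pc.
  apply: closedI; apply: preimage_closed.
  + by move=> p _; exact: continuous_sq_rsubmx.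
  + by apply: accessible_closed_set1; apply: hausdorff_accessible; exact: Rhausdorff.
  + by move=> p _; exact: continuous_sq_lsubmx.
  + exact: closed_le.
move=> p /= [pc pb] i; rewrite /= in_itv /= -ler_norml.
have ple : p 0 i ^+ 2 <= b + rho2.
  apply: le_trans (sqr_le_dotp p i) _; rewrite dotp_submx.
  by rewrite lerD // dotp_rsubmx_cylinder.
rewrite -real_normK ?num_real // in ple.
have := sqr_ge0 (`|p ord0 i| - 1); have := normr_ge0 (p ord0 i).
by rewrite /B; nra.
Qed.


(** * The minimum of the potential on a hypersurface *)

Lemma smooth_map_continuous {R : realType} {n : nat} {V : normedModType R}
    (M : manifold R n) (F : M -> V) : smooth_map F -> continuous F.
Proof.
move=> Fs p; have [c [ac cp]] := atlas_cover p.
have Fc : {for cmap c p, continuous (F \o cinv c)} := Fs c ac 0%N _ (cmap_img cp).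
have H : {for p, continuous ((F \o cinv c) \o cmap c)}.
  by apply: continuous_comp => //; exact: cmap_continuous.
have near_p : \forall q \near p, ((F \o cinv c) \o cmap c) q = F q.
  have : \forall q \near p, cdom c q.
    by apply: open_nbhs_nbhs; split => //; exact: cdom_open.
  by apply: filterS => q cq /=; rewrite cmapK.
have := cvg_trans (near_eq_cvg near_p) H.
by rewrite /= cmapK //; apply.
Qed.

(** Properness makes the part of the hypersurface where |x|^2 does not exceed one of
    its values compact. *)
Lemma exists_potential_min {R : realType} {m k n : nat} (M : manifold R n)
    (F : M -> 'rV[R]_(m + k.+1)) :
  (2 <= k)%N -> (forall p, cylinder (F p)) -> smooth_map F ->
  properly_immersed F ->
  exists p, forall q, dotp (lsubmx (F p)) (lsubmx (F p)) <=
                      dotp (lsubmx (F q)) (lsubmx (F q)).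
Proof.
move=> k2 Fc Fs Fp; have [p0 _] := manifold_nonempty M.
pose f q := dotp (lsubmx (F q)) (lsubmx (F q)).
pose K : set 'rV[R]_(m + k.+1) :=
  [set p | cylinder p /\ dotp (lsubmx p) (lsubmx p) <= f p0].
have cK : compact (F @^-1` K).
  by apply: Fp; [move=> ? [] | exact: compact_cylinder_sublevel].
have fc : continuous f.
  move=> q.
  exact: (@continuous_comp _ _ _ F (fun u => dotp (lsubmx u) (lsubmx u)) q
    (smooth_map_continuous Fs (x := q)) (continuous_sq_lsubmx (x := F q))).
have [||c] := @compact_EVT_min M R f (F @^-1` K) _ cK.
- by exists p0; split.
- exact: continuous_subspaceT.
rewrite inE => -[_ cp0] cmin; exists c => q.
have [qp0|/ltW qp0] := leP (f q) (f p0); last exact: le_trans qp0.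
by apply: cmin; rewrite inE; split.
Qed.

(** This is the derivative of the constant |y|^2 along a coordinate direction. *)
Lemma frame_tangent_cylinder {R : realType} {m k n : nat} (M : manifold R n)
    (F N : M -> 'rV[R]_(m + k.+1)) (c : chart R n M) (z : 'rV[R]_n) (i : 'I_n) :
  (2 <= k)%N -> oriented_immersed_hypersurface F N -> atlas c -> cimg c z ->
  dotp (rsubmx (row i (frame F c z))) (rsubmx (F (cinv c z))) = 0.
Proof.
move=> k2 hM ac cz; rewrite rowK.
have dG : is_derive z (delta_mx 0 i) (F \o cinv c) (partial i (F \o cinv c) z).
  by apply/derivableP/diff_derivable; exact: (himm_smooth hM ac 1%N).1.
have : is_derive z (delta_mx 0 i)
    (fun y => dotp (rsubmx ((F \o cinv c) y)) (rsubmx ((F \o cinv c) y)))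
    (dotp (rsubmx (partial i (F \o cinv c) z)) (rsubmx (F (cinv c z))) +
     dotp (rsubmx (F (cinv c z))) (rsubmx (partial i (F \o cinv c) z))).
  by apply: is_derive_dotp => j; exact: is_derive_rsubmx.
have -> : (fun y => dotp (rsubmx ((F \o cinv c) y)) (rsubmx ((F \o cinv c) y)))
    = cst (2 * (k%:R - 1)).
  by apply/funext => y; rewrite dotp_rsubmx_cylinder //; exact: (himm_cylinder hM).
move=> [_]; rewrite derive_cst [dotp (rsubmx (F _)) _]dotpC.
by lra.
Qed.

(** The right-hand side is twice the Laplacian of |x|^2 / 4 on the hypersurface,
    at a critical point: see the discussion at the top. *)
Lemma potential_min_laplacian_ge0 {R : realType} {m k n : nat} (M : manifold R n)
    (F N : M -> 'rV[R]_(m + k.+1)) (c : chart R n M) (z : 'rV[R]_n) :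
  (2 <= k)%N -> (m + k.+1 = n + (1 + 1))%N ->
  oriented_immersed_hypersurface F N -> atlas c -> cimg c z ->
  let p := cinv c z in
  (forall q, dotp (lsubmx (F p)) (lsubmx (F p)) <=
             dotp (lsubmx (F q)) (lsubmx (F q))) ->
  0 <= m%:R - dotp (lsubmx (N p)) (lsubmx (N p)) +
       dotp (lsubmx (F p)) (lsubmx (N p)) *
       \tr (invmx (induced_metric F c z) *m second_form F N c z).
Proof.
move=> k2 dE hM ac cz p pmin.
pose E := frame F c z; pose nu := N p; pose G := F \o cinv c.
pose y := rsubmx (F p).
have yy : dotp y y = 2 * (k%:R - 1).
  by rewrite dotp_rsubmx_cylinder //; exact: (himm_cylinder hM).
have yy0 : 0 < dotp y y.
  by rewrite yy mulr_gt0 // subr_gt0 ltr1n.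
have nuT : tproj (F p) nu = nu := hnormal_tangent hM p.
have nuy : dotp (rsubmx nu) y = 0 by apply: tproj_fixed_dotp => //; exact: lt0r_neq0.
(* The outward unit normal of the cylinder. *)
pose eta : 'rV[R]_(m + k.+1) := row_mx 0 ((enorm y)^-1 *: y).
have leta : lsubmx eta = 0 by rewrite row_mxKl.
have doteta u : dotp u eta = (enorm y)^-1 * dotp (rsubmx u) y.
  by rewrite dotpC dotp_submx leta row_mxKr dotpZl dotpE mul0mx mxE add0r dotpC.
have nn : dotp nu nu = 1 by rewrite -enorm_sqr (hnormal_unit hM) expr1n.
have ne : dotp nu eta = 0 by rewrite doteta nuy mulr0.
have ee : dotp eta eta = 1.
  rewrite doteta row_mxKr dotpZl -enorm_sqr expr2 mulrA.
  have e0 : enorm y != 0 by rewrite -sqrf_eq0 enorm_sqr lt0r_neq0.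
  by field.
have mulET u : E *m u^T = 0 <-> forall i, dotp (row i E) u = 0.
  split=> [Eu i|Eu].
    by rewrite dotpE -row_mul Eu !mxE.
  apply/matrixP => i j; rewrite (ord1 j) [RHS]mxE -(Eu i) [LHS]mxE.
  by apply: eq_bigr => l _; rewrite !mxE.
have Efree : row_free E by exact: (himm_immersion hM).
have En : E *m nu^T = 0.
  by apply/mulET => i; rewrite dotpC; exact: (hnormal_normal hM).
have Ee : E *m eta^T = 0.
  by apply/mulET => i; rewrite doteta (frame_tangent_cylinder i k2 hM) ?mulr0.
have Gmin w : dotp (lsubmx (G z)) (lsubmx (G z)) <= dotp (lsubmx (G w)) (lsubmx (G w)).
  exact: pmin.
have test v := sq_lsubmx_min_test v (cimg_open (c:=c)) (himm_smooth hM ac 2) cz Gmin.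
have vE (v : 'rV[R]_n) : \sum_i v 0 i *: partial i G z = v *m E.
  by rewrite mulmx_sum_row; apply: eq_bigr => i _; rewrite rowK.
pose x : 'rV[R]_(m + k.+1) := row_mx (lsubmx (F p)) 0.
have dotx u : dotp u x = dotp (lsubmx u) (lsubmx (F p)).
  rewrite dotpC dotp_submx row_mxKl row_mxKr [dotp 0 _]dotpE mul0mx mxE addr0.
  exact: dotpC.
(* p is a critical point of |x|^2. *)
have Ex : E *m x^T = 0.
  apply/mulET => i; rewrite dotx; have [] := test (delta_mx 0 i).
  by rewrite vE -rowE.
have xe : dotp x eta = 0 by rewrite dotpC dotx leta dotpE mul0mx mxE.
have xnu := normal_component dE Efree En Ee nn ee ne Ex xe.
have sE : dotp x nu = dotp (lsubmx (F p)) (lsubmx nu) by rewrite dotpC dotx dotpC.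
have AE i j : second_form F N c z i j = dotp (partial i (partial j G) z) nu.
  rewrite mxE /nablabar dotp_tproj nuT; congr (dotp (partial i _ z) _).
  by apply/funext => w; rewrite rowK.
have -> : induced_metric F c z = E *m E^T.
  by apply/matrixP => i j; rewrite !mxE; apply: eq_bigr => l _; rewrite !mxE.
apply: (trace_nonneg_form (eta := eta)) => // v.
have [_] := test v; rewrite vE; set ddG := \sum_i _.
suff -> : dotp (lsubmx ddG) (lsubmx (G z)) =
    dotp (lsubmx (F p)) (lsubmx nu) * (v *m second_form F N c z *m v^T) 0 0 by [].
rewrite -[LHS](dotx ddG) xnu sE dotpC dotpZl; congr (_ * _).
rewrite dotpC /ddG dotp_suml [RHS]mxE; under [RHS]eq_bigr do rewrite mxE mulr_suml.
rewrite [RHS]exchange_big /=; apply: eq_bigr => i _; rewrite dotp_suml.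
by apply: eq_bigr => j _; rewrite dotpZl -AE [v^T _ _]mxE mulrAC.
Qed.


(** * Mean curvature bound *)

(** With s the square root, the assumption says 2 H - h >= s >= 0, and squaring it
    gives 4 H^2 - 4 H h >= 2 m. *)
Lemma weighted_threshold {R : realType} (m H h : R) :
  0 <= m -> (h + Num.sqrt (h ^+ 2 + 2 * m)) / 2 <= H ->
  m <= 2 * (H * (H - h)).
Proof.
move=> m0 Hge; have D0 : 0 <= h ^+ 2 + 2 * m by rewrite addr_ge0 ?sqr_ge0 ?mulr_ge0.
have s0 := sqrtr_ge0 (h ^+ 2 + 2 * m).
have sqs := sqr_sqrtr D0.
by set s := Num.sqrt _ in s0 sqs Hge; nra.
Qed.

Theorem corollary8 (R : realType) (n k : nat)
    (hn : (3 <= n)%N) (hk2 : (2 <= k)%N) (hkn : (k <= n - 1)%N)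
    (M : manifold R n) (F N : M -> 'rV[R]_((n.+1 - k) + k.+1))
    (hM : oriented_immersed_hypersurface F N)
    (hcomplete : complete_hypersurface F)
    (hproper : properly_immersed F)
    (Hf : R) (hCWMC : forall p : M, weighted_mean_curvature F N p = Hf) :
  (ereal_inf [set (mean_curvature F N p)%:E | p in [set: M]] <
   ((Hf + Num.sqrt (Hf ^+ 2 + 2 * (n.+1 - k)%:R)) / 2)%:E)%E.
Proof.
have kn : (k < n.+1)%N by rewrite ltnS (leq_trans hkn) ?leq_subr.
have [p pmin] := exists_potential_min hk2 (himm_cylinder hM) (himm_smooth hM) hproper.
apply/ereal_inf_ltP; exists (mean_curvature F N p)%:E; first by exists p.
rewrite lte_fin ltNge; apply/negP => Hge.
have m0 : 0 < (n.+1 - k)%:R :> R by rewrite ltr0n subn_gt0.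
have {Hge} mH := weighted_threshold (ltW m0) Hge.
have [ac cp] := projT2 (cid (atlas_cover p)).
have dE : (n.+1 - k + k.+1 = n + (1 + 1))%N.
  by rewrite addnS subnK ?(ltnW kn) // addn2.
have := potential_min_laplacian_ge0 hk2 dE hM ac (cmap_img cp).
rewrite /= (cmapK cp) => /(_ pmin).
have := hCWMC p; rewrite /weighted_mean_curvature.
rewrite dotp_gradbar_potential; last exact: (hnormal_tangent hM p).
move: mH; rewrite /mean_curvature /chart_at.
set T := \tr _; set s := dotp (lsubmx (F p)) _; set q := dotp _ _.
move=> mH HE ineq.
(* |N_x|^2 <= m - 2 H (H - H_f) <= 0 *)
have q0 : q = 0.
  have := dotp_ge0 (lsubmx (N p)); rewrite -/q => q0.
  by apply/eqP; rewrite eq_le q0 andbT; nra.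
have s0 : s = 0 by rewrite /s (dotp_eq0 q0) dotpC dotpE mul0mx mxE.
by move: mH; rewrite -HE s0 => mH; nra.
Qed.
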